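(* For every infinite cardinal $\kappa$ satisfying $\kappa^\omega=\kappa$, there exists a pseudocompact strongly self-dual Boolean topological group $G$ which is not selectively pseudocompact and satisfies $|G|=w(G)=\kappa$.
   Context: All topological groups are assumed to be Hausdorff. $w(G)$ denotes the weight of $G$ (the minimal cardinality of a base of its topology). A group $G$ is Boolean if $x^2=e$ for every $x\in G$, where $e$ is the identity element (every Boolean group is abelian). A space is pseudocompact if every continuous real-valued function on it is bounded. For an abelian topological group $G$, its Pontryagin dual $G^\wedge$ is the group of all continuous group homomorphisms from $G$ to the circle group $\mathbb{T}$, endowed with the compact-open topology. $G$ is strongly self-dual if there exists a topological isomorphism $\Phi:G\to G^\wedge$ of $G$ onto $G^\wedge$ such that $\Phi(x)(y)=\Phi(y)(x)$ for all $x,y\in G$. A point $x$ of a topological space $X$ is an accumulation point of a sequence $\{x_n:n\in\mathbb{N}\}$ of points of $X$ if the set $\{n\in\mathbb{N}: x_n\in V\}$ is infinite for every neighbourhood $V$ of $x$ in $X$. A topological space $X$ is selectively pseudocompact if for every sequence $\{U_n:n\in\mathbb{N}\}$ of non-empty open subsets of $X$ one can choose $x_n\in U_n$ for every $n\in\mathbb{N}$ such that the sequence $\{x_n:n\in\mathbb{N}\}$ has an accumulation point in $X$. *)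

(* Defs.v *)
From HB Require Import structures.
From mathcomp Require Import all_boot all_order all_algebra complex.
From mathcomp Require Import all_classical all_reals all_analysis.

Set Implicit Arguments.
Unset Strict Implicit.
Unset Printing Implicit Defensive.

Import Order.TTheory GRing.Theory Num.Theory.
Import numFieldNormedType.Exports.

Local Open Scope classical_set_scope.
Local Open Scope card_scope.
Local Open Scope ring_scope.
Local Open Scope complex_scope.

(* The sort of this [numFieldType] is R[i]; going through the packed structure
   makes the topology that every [numFieldType] gets from its norm available. *)
Definition complex_plane (R : realType) : numFieldType := R[i].

Definition unit_circle (R : realType) : set (complex_plane R) :=
  [set z | `|z| = 1].

Definition circle (R : realType) : Type := set_type (@unit_circle R).

HB.instance Definition _ (R : realType) := SubType.on (circle R).
HB.instance Definition _ (R : realType) := Topological.on (circle R).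

Section circle_group.
Variable R : realType.
Implicit Types z t u : circle R.

Lemma norm_circle z : `|val z| = 1.
Proof. by case: z => z /= /set_mem. Qed.

Lemma circle_neq0 z : val z != 0.
Proof. by rewrite -normr_eq0 norm_circle oner_eq0. Qed.

Fact circle_one_subproof : (1 : complex_plane R) \in @unit_circle R.
Proof. by apply/mem_set; rewrite /unit_circle /= normr1. Qed.

Fact circle_mul_subproof z t : val z * val t \in @unit_circle R.
Proof. by apply/mem_set; rewrite /unit_circle /= normrM !norm_circle mulr1. Qed.

Fact circle_inv_subproof z : (val z)^-1 \in @unit_circle R.
Proof. by apply/mem_set; rewrite /unit_circle /= normfV norm_circle invr1. Qed.

Definition circle_one : circle R := SigSub circle_one_subproof.
Definition circle_mul z t : circle R := SigSub (circle_mul_subproof z t).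
Definition circle_inv z : circle R := SigSub (circle_inv_subproof z).

Fact circle_mulA : associative circle_mul.
Proof. by move=> z t u; apply/val_inj; rewrite /= mulrA. Qed.

Fact circle_mulC : commutative circle_mul.
Proof. by move=> z t; apply/val_inj; rewrite /= mulrC. Qed.

Fact circle_mul1 : left_id circle_one circle_mul.
Proof. by move=> z; apply/val_inj; rewrite /= mul1r. Qed.

Fact circle_mulV : left_inverse circle_one circle_inv circle_mul.
Proof. by move=> z; apply/val_inj; rewrite /= mulVf // circle_neq0. Qed.

(* The library's topological groups are additive, so the multiplicative group
   of the circle is written additively: [z + t] is the complex product. *)
HB.instance Definition _ := GRing.isZmodule.Build (circle R)
  circle_mulA circle_mulC circle_mul1 circle_mulV.

Lemma val_circle0 : val (0 : circle R) = 1.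
Proof. by []. Qed.

Lemma val_circleD z t : val (z + t) = val z * val t.
Proof. by []. Qed.

Lemma val_circleN z : val (- z) = (val z)^-1.
Proof. by []. Qed.

Lemma continuous_to_circle (X : topologicalType) (f : X -> circle R) :
  continuous (fun x => val (f x) : complex_plane R) -> continuous f.
Proof.
move=> /continuousP cf; apply/continuousP => _ [V oV <-].
exact: (cf V oV).
Qed.

Lemma continuous_circle_val :
  continuous (fun z : circle R => val z : complex_plane R).
Proof. exact: (@initial_continuous (circle R) _ set_val). Qed.

Fact circle_sub_continuous :
  continuous (fun zt : circle R * circle R => zt.1 - zt.2).
Proof.
apply: continuous_to_circle => -[z t].
apply: (@cvgM _ _ (nbhs (z, t))).
  apply: (@continuous_comp _ _ _ fst) => /=; first exact: cvg_fst.
  exact: continuous_circle_val.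
apply: cvgV; first exact: circle_neq0.
apply: (@continuous_comp _ _ _ snd) => /=; first exact: cvg_snd.
exact: continuous_circle_val.
Qed.

HB.instance Definition _ :=
  PreTopologicalNmodule_isTopologicalZmodule.Build (circle R)
  circle_sub_continuous.

End circle_group.

Definition is_character (R : realType) (G : topologicalZmodType)
    : set {compact-open, G -> circle R} :=
  [set f | continuous (f : G -> circle R) /\
           {morph (f : G -> circle R) : x y / x + y}].

(* The subtype topology is the one induced by the compact-open topology. *)
Definition dual (R : realType) (G : topologicalZmodType) : Type :=
  set_type (@is_character R G).

HB.instance Definition _ (R : realType) (G : topologicalZmodType) :=
  SubType.on (dual R G).
HB.instance Definition _ (R : realType) (G : topologicalZmodType) :=
  Topological.on (dual R G).

Definition dual_fun (R : realType) (G : topologicalZmodType) (f : dual R G)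
  : G -> circle R := val f.

Coercion dual_fun : dual >-> Funclass.

Section dual_group.
Variables (R : realType) (G : topologicalZmodType).
Implicit Types f g : dual R G.

Lemma dual_continuous f : continuous (f : G -> circle R).
Proof. by have /set_mem[] := valP f. Qed.

Lemma dualD f : {morph (f : G -> circle R) : x y / x + y}.
Proof. by have /set_mem[] := valP f. Qed.

Lemma dual_ext f g : (forall x, f x = g x) -> f = g.
Proof. by move=> fg; apply/val_inj/funext. Qed.

Fact dual_zero_subproof :
  ((fun=> 0) : {compact-open, G -> circle R}) \in @is_character R G.
Proof.
by apply/mem_set; split=> [x|x y /=]; [exact: cvg_cst | rewrite addr0].
Qed.

Fact dual_add_subproof f g :
  ((fun x => f x + g x) : {compact-open, G -> circle R})
    \in @is_character R G.
Proof.
apply/mem_set; split=> [x|x y /=]; last by rewrite !dualD addrACA.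
apply: (@cvg_comp _ _ _ (fun x => (f x, g x))
  (fun zt : circle R * circle R => zt.1 + zt.2)); last first.
  exact: (@add_continuous (circle R) (f x, g x)).
exact: (@cvg_pair G (circle R) (circle R) (nbhs x) (nbhs (f x)) (nbhs (g x))
  _ _ _ f g (@dual_continuous f x) (@dual_continuous g x)).
Qed.

Fact dual_opp_subproof f :
  ((fun x => - f x) : {compact-open, G -> circle R}) \in @is_character R G.
Proof.
apply/mem_set; split=> [x|x y /=]; last by rewrite dualD opprD.
apply: (@continuous_comp _ _ _ (f : G -> circle R) -%R).
  exact: dual_continuous.
exact: opp_continuous.
Qed.

Definition dual_zero : dual R G := SigSub dual_zero_subproof.
Definition dual_add f g : dual R G := SigSub (dual_add_subproof f g).
Definition dual_opp f : dual R G := SigSub (dual_opp_subproof f).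

Fact dual_addA : associative dual_add.
Proof. by move=> f g h; apply: dual_ext => x; exact: addrA. Qed.

Fact dual_addC : commutative dual_add.
Proof. by move=> f g; apply: dual_ext => x; exact: addrC. Qed.

Fact dual_add0 : left_id dual_zero dual_add.
Proof. by move=> f; apply: dual_ext => x; exact: add0r. Qed.

Fact dual_addN : left_inverse dual_zero dual_opp dual_add.
Proof. by move=> f; apply: dual_ext => x; exact: addNr. Qed.

HB.instance Definition _ := GRing.isZmodule.Build (dual R G)
  dual_addA dual_addC dual_add0 dual_addN.

End dual_group.

Definition topological_isomorphism (G H : PreTopologicalZmodule.type)
    (Phi : G -> H) : Prop :=
  {morph Phi : x y / x + y} /\
  exists Psi : H -> G,
    [/\ cancel Phi Psi, cancel Psi Phi, continuous Phi & continuous Psi].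

Definition strongly_self_dual (R : realType) (G : topologicalZmodType)
    : Prop :=
  exists Phi : G -> dual R G,
    topological_isomorphism Phi /\ forall x y : G, Phi x y = Phi y x.

(* A Boolean group is abelian, so nothing is lost by working additively. *)
Definition boolean_group (G : zmodType) : Prop := forall x : G, x + x = 0.

Definition pseudocompact (R : realType) (X : topologicalType) : Prop :=
  forall f : X -> R, continuous f -> exists M : R, forall x : X, `|f x| <= M.

Definition accumulation_point (X : topologicalType) (u : nat -> X) (x : X)
    : Prop :=
  forall V : set X, nbhs x V -> infinite_set [set n | V (u n)].

Definition selectively_pseudocompact (X : topologicalType) : Prop :=
  forall U : nat -> set X,
    (forall n, open (U n) /\ U n !=set0) ->
    exists u : nat -> X,
      (forall n, U n (u n)) /\ exists x : X, accumulation_point u x.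

(* w(X) = |K|: the least cardinality of a base of X is that of the type K. *)
Definition weight_eq (X : topologicalType) (K : Type) : Prop :=
  (exists2 B : set (set X), basis B & B #= [set: K]) /\
  (forall B : set (set X), basis B -> [set: K] #<= B).

(* Main.v *)
(* Let I be the set of countably branching well-founded trees with leaves in K
   and bits on the edges; |I| = kappa because kappa^omega = kappa. Join two
   trees when one is an immediate subtree of the other along an edge with bit 1.
   Given trees j_0, j_1, ... and a prescribed set A of them, the node with
   subtrees j_n and bits [j_n in A] is adjacent exactly to the members of A: by
   well-foundedness it is not itself an immediate subtree of any j_n. So the
   symmetric adjacency matrix b of this graph realises every 0-1 pattern on
   every countable subset of I as a row.
   G is the span of the rows of b in F_2^I with the pointwise topology, and
   <b_i, x> = x i defines a symmetric nondegenerate pairing on G. Its topology is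
   the weak topology of the pairing, so every character of G is <x, .> for some
   x. By the pattern property G projects onto F_2^J for countable J, whence G is
   pseudocompact; with an ultrafilter limit, countable systems of equations
   <u_n, y> = e_n are solvable as soon as their finite subsystems are. Hence a
   linearly independent sequence has no accumulation point: compact sets are
   finite, the dual carries the pointwise topology, and G is strongly self-dual.
   Finally a choice x_n in U_n = {x | x i_k = 0 for k < n, x i_n = 1} is always
   independent. *)
Require Import Defs.
From HB Require Import structures.
From mathcomp Require Import all_boot all_order all_algebra complex.
From mathcomp Require Import all_classical all_reals all_analysis.

Import Order.TTheory GRing.Theory Num.Theory.
Import numFieldNormedType.Exports.

Local Open Scope classical_set_scope.
Local Open Scope card_scope.
Local Open Scope ring_scope.

Set Implicit Arguments.
Unset Strict Implicit.
Unset Printing Implicit Defensive.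

(** * The row space of a matrix over F_2 as a topological group *)

(** Addition in [bool] is exclusive or, so repeated indices cancel. *)
Definition row_sum (I : choiceType) (b : I -> I -> bool) (s : seq I) (k : I)
  : bool := \sum_(i <- s) b i k.

Definition row_space (I : choiceType) (b : I -> I -> bool) : Type :=
  set_type (range (row_sum b)).

Section row_space_group.
Variables (I : choiceType) (b : I -> I -> bool).
Local Notation G := (row_space b).

HB.instance Definition _ := SubType.on G.
HB.instance Definition _ := Choice.on G.

Definition row_fun (x : G) : I -> bool := val x.
Local Coercion row_fun : row_space >-> Funclass.

Lemma row_ext (x y : G) : (forall i, x i = y i) -> x = y.
Proof. by move=> xy; apply/val_inj/funext. Qed.

Lemma mem_row_sum s : row_sum b s \in range (row_sum b).
Proof. by apply/mem_set; exists s. Qed.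

Definition row_vec (s : seq I) : G := SigSub (mem_row_sum s).

Lemma row_vecP (x : G) : exists s, x = row_vec s.
Proof. by have /set_mem[s _ xs] := valP x; exists s; apply/val_inj. Qed.

Definition row_supp (x : G) : seq I := projT1 (cid (row_vecP x)).

Lemma row_suppK : cancel row_supp row_vec.
Proof. by move=> x; rewrite /row_supp; case: cid => s. Qed.

Definition row_add (x y : G) : G := row_vec (row_supp x ++ row_supp y).

Lemma row_addE x y i : row_add x y i = x i + y i.
Proof.
by rewrite -{2}(row_suppK x) -{2}(row_suppK y) /row_fun /= /row_sum big_cat.
Qed.

Fact row_addA : associative row_add.
Proof. by move=> x y z; apply: row_ext => i; rewrite !row_addE addrA. Qed.

Fact row_addC : commutative row_add.
Proof. by move=> x y; apply: row_ext => i; rewrite !row_addE addrC. Qed.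

Lemma row_vec0E i : row_vec [::] i = 0.
Proof. by rewrite /row_fun /= /row_sum big_nil. Qed.

Fact row_add0 : left_id (row_vec [::]) row_add.
Proof.
by move=> x; apply: row_ext => i; rewrite row_addE row_vec0E add0r.
Qed.

Fact row_addN : left_inverse (row_vec [::]) id row_add.
Proof.
by move=> x; apply: row_ext => i; rewrite row_addE row_vec0E; exact: addbb.
Qed.

HB.instance Definition _ := GRing.isZmodule.Build G
  row_addA row_addC row_add0 row_addN.

Lemma row0E i : (0 : G) i = 0. Proof. exact: row_vec0E. Qed.

Lemma rowDE (x y : G) i : (x + y : G) i = x i + y i. Proof. exact: row_addE. Qed.

Lemma row_boolean : boolean_group G.
Proof. exact: row_addN. Qed.

Lemma rowN (x : G) : - x = x. Proof. by []. Qed.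

Definition row_nbhs (x : G) : set_system G :=
  [set A | exists s : seq I, forall y : G, {in s, y =1 x} -> A y].

HB.instance Definition _ := hasNbhs.Build G row_nbhs.

Fact row_nbhs_filter (x : G) : ProperFilter (nbhs x).
Proof.
apply: Build_ProperFilter_ex => [A [s sA]|].
  by exists x; apply: sA.
split; first by exists [::].
  move=> A B [s sA] [t tB]; exists (s ++ t) => y yx.
  by split; [apply: sA|apply: tB] => i ist; apply: yx; rewrite mem_cat ist ?orbT.
by move=> A B AB [s sA]; exists s => y /sA/AB.
Qed.

Fact row_nbhs_singleton (x : G) (A : set G) : nbhs x A -> A x.
Proof. by move=> [s]; exact. Qed.

Fact row_nbhs_nbhs (x : G) (A : set G) : nbhs x A -> nbhs x (nbhs^~ A).
Proof.
move=> [s sA]; exists s => y yx; exists s => z zy; apply: sA => i si.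
by rewrite zy ?yx.
Qed.

HB.instance Definition _ := Nbhs_isNbhsTopological.Build G
  row_nbhs_filter row_nbhs_singleton row_nbhs_nbhs.

Lemma nbhs_row (x : G) (s : seq I) : nbhs x [set y : G | {in s, y =1 x}].
Proof. by exists s. Qed.

Fact row_sub_continuous : continuous (fun xy : G * G => xy.1 - xy.2).
Proof.
move=> [x y] A [s sA].
exists ([set z : G | {in s, z =1 (x : G)}], [set z : G | {in s, z =1 (y : G)}]) => /=.
  by split; exact: nbhs_row.
move=> [z t] [/= zx ty]; apply: sA => i si.
by rewrite !rowN !rowDE zx ?ty.
Qed.

HB.instance Definition _ :=
  PreTopologicalNmodule_isTopologicalZmodule.Build G row_sub_continuous.

End row_space_group.

Coercion row_fun : row_space >-> Funclass.

(** * Finite spans in Boolean groups *)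

(* The span over F_2: a coefficient is either 0 or 1. *)
Fixpoint in_span (G : zmodType) (zs : seq G) (w : G) : Prop :=
  if zs is z :: zs' then in_span zs' w \/ in_span zs' (w + z) else w = 0.

Section span.
Variable G : zmodType.
Hypothesis G2 : boolean_group G.

Lemma boolean_addK (x y : G) : x + y + y = x.
Proof. by rewrite -addrA G2 addr0. Qed.

Lemma in_span_morph (zs : seq G) (w : G) (c : G -> bool) :
    {morph c : x y / x + y} -> {in zs, forall z, c z = 0} -> in_span zs w ->
  c w = 0.
Proof.
move=> cD; elim: zs w => [w _ ->|z zs IH w c0 /=].
  by have := cD 0 0; rewrite addr0; case: (c 0).
have IH' u : in_span zs u -> c u = 0.
  by apply: IH => v vs; apply: c0; rewrite inE vs orbT.
by case=> /IH' //; rewrite cD (c0 z (mem_head _ _)) addr0.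
Qed.

Lemma finite_in_span (zs : seq G) : exists s : seq G, in_span zs `<=` [set` s].
Proof.
elim: zs => [|z zs [s sP]]; first by exists [:: 0] => w /= ->; exact: mem_head.
exists (s ++ [seq x + z | x <- s]) => w /= [/sP|/sP] /= ws.
  by rewrite mem_cat ws.
by rewrite mem_cat; apply/orP; right; apply/mapP; exists (w + z); rewrite ?boolean_addK.
Qed.

End span.

(** * Rich matrices: the pairing and countable linear systems *)

(** The pattern [A] is a function of [j n], not of [n], so repetitions in [j] cannot conflict. *)
Definition rich_matrix (I : choiceType) (b : I -> I -> bool) : Prop :=
  (forall i j, b i j = b j i) /\
  forall (j : nat -> I) (A : I -> bool),
    exists i, forall n, b i (j n) = A (j n).

Lemma ultra_limit (U : set_system nat) (I : Type) (f : nat -> I -> bool) :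
  UltraFilter U -> exists h : I -> bool, forall i, U [set n | f n i = h i].
Proof.
move=> UU; suff /choice[h hP] : forall i, exists v, U [set n | f n i = v].
  by exists h.
move=> i; have [Ui|Ui] := in_ultra_setVsetC [set n | f n i = true] UU.
  by exists true.
by exists false; apply: filterS Ui => n /=; case: (f n i).
Qed.

Lemma filter_in_seq (T : Type) (U : set_system T) (I : eqType) (s : seq I)
    (P : I -> set T) :
  Filter U -> {in s, forall i, U (P i)} -> U [set n | {in s, forall i, P i n}].
Proof.
move=> UF; elim: s => [_|i s IH UP].
  by apply: filterS (@filterT _ U UF).
have Ui := UP i (mem_head _ _).
have Us : U [set n | {in s, forall i, P i n}].
  by apply: IH => j js; apply: UP; rewrite inE js orbT.
apply: filterS (filterI Ui Us) => n [Pi Ps] j.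
by rewrite inE => /predU1P[->//|/Ps].
Qed.

Lemma nat_ultrafilter : exists U : set_system nat,
  UltraFilter U /\ forall N, U [set n | (N <= n)%N].
Proof.
have [U [UU sU]] := @ultraFilterLemma nat \oo _.
by exists U; split=> // N; apply: sU; exists N.
Qed.

Section rich.
Variables (I : choiceType) (b : I -> I -> bool).
Hypothesis b_rich : rich_matrix b.
Local Notation G := (row_space b).

Lemma rich_ext (j : nat -> I) (A : I -> bool) :
  exists x : G, forall n, x (j n) = A (j n).
Proof.
have [i iA] := b_rich.2 j A; exists (row_vec b [:: i]) => n.
by rewrite /row_fun /= /row_sum big_seq1.
Qed.

Lemma rich_ext_seq (s : seq I) (A : I -> bool) :
  exists x : G, {in s, x =1 A}.
Proof.
case: s => [|i s]; first by exists 0.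
have [x xA] := rich_ext (nth i (i :: s)) A; exists x => k /(nthP i)[n _ <-].
exact: xA.
Qed.

Lemma rich_ext_seqs (s : nat -> seq I) (A : I -> bool) :
  exists x : G, forall n, {in s n, x =1 A}.
Proof.
have [[n0 [i0 _]]|s0] := pselect (exists n, exists i, i \in s n); last first.
  by exists 0 => n i si; case: s0; exists n, i.
pose j k := if unpickle k is Some (n, m) then nth i0 (s n) m else i0.
have [x xA] := rich_ext j A; exists x => n i /(nthP i0)[m _ <-].
by have := xA (pickle (n, m)); rewrite /j pickleK.
Qed.

(** The value does not depend on the chosen list [row_supp x]: by symmetry of [b] it is also the sum
    of [x] over [row_supp y]. *)
Definition pairing (x y : G) : bool := \sum_(i <- row_supp x) y i.

Lemma pairingC (x y : G) : pairing x y = pairing y x.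
Proof.
rewrite /pairing -{2}(row_suppK x) -{1}(row_suppK y) /row_fun /= /row_sum.
rewrite exchange_big /=; apply: eq_bigr => i _; apply: eq_bigr => j _.
exact: b_rich.1.
Qed.

Lemma pairingDr (x : G) : {morph pairing x : y z / y + z}.
Proof.
by move=> y z; rewrite /pairing -big_split; apply: eq_bigr => i _; exact: rowDE.
Qed.

Lemma pairingDl (x y z : G) : pairing (x + y) z = pairing x z + pairing y z.
Proof. by rewrite !(pairingC _ z) pairingDr. Qed.

Lemma pairing0r (x : G) : pairing x 0 = 0.
Proof. by rewrite /pairing big1 // => i _; exact: row0E. Qed.

Lemma pairing_row (x : G) i : pairing x (row_vec b [:: i]) = x i.
Proof.
rewrite -[in RHS](row_suppK x) /pairing /row_fun /= /row_sum.
by apply: eq_bigr => k _; rewrite big_seq1 b_rich.1.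
Qed.

Lemma pairing_inj (x y : G) : (forall z, pairing x z = pairing y z) -> x = y.
Proof. by move=> xy; apply: row_ext => i; rewrite -!pairing_row. Qed.

Lemma nbhs_pairing (x y : G) : nbhs x [set z | pairing z y = pairing x y].
Proof.
exists (row_supp y) => z zx /=; rewrite !(pairingC _ y) /pairing.
by apply: eq_big_seq => i /zx.
Qed.

(** Induction on [zs]: if [c] does not already vanish where the tail does, some [z0] there has c z0
    = 1 = <z, z0>, and c + <z, .> satisfies the hypothesis for the tail. *)
Lemma dual_span (zs : seq G) (c : G -> bool) :
    {morph c : x y / x + y} ->
    (forall y, {in zs, forall z, pairing z y = 0} -> c y = 0) ->
  exists2 w, in_span zs w & forall y, c y = pairing w y.
Proof.
elim: zs c => [|z zs IH] c cD c0.
  by exists 0 => // y; rewrite pairingC pairing0r c0.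
have [czs|/existsNP[z0 /not_implyP[z0s cz0]]] := pselect (forall y,
    {in zs, forall z, pairing z y = 0} -> c y = 0).
  by have [w ws wc] := IH c cD czs; exists w => //; left.
have {}cz0 : c z0 = 1 by case: (c z0) cz0.
have zz0 : pairing z z0 = 1.
  case zz0: (pairing z z0) => //.
  suff : c z0 = 0 by rewrite cz0.
  by apply: c0 => u; rewrite inE => /predU1P[->//|]; exact: z0s.
have [|y ys|w ws wc] := IH (fun y => c y + pairing z y).
- by move=> x y; rewrite cD pairingDr addrACA.
- case zy: (pairing z y).
    suff : c (y + z0) = 0 by rewrite cD cz0.
    apply: c0 => u; rewrite inE pairingDr => /predU1P[->|us].
      by rewrite zy zz0.
    by rewrite ys // z0s.
  rewrite addr0; apply: c0 => u; rewrite inE => /predU1P[->//|]; exact: ys.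
- exists (w + z); first by right; rewrite boolean_addK //; exact: row_boolean.
  move=> y; rewrite pairingDl -wc -addrA.
  by rewrite (_ : pairing z y + _ = 0) ?addr0 //; exact: addbb.
Qed.

Lemma separate_span (zs : seq G) (w : G) : ~ in_span zs w ->
  exists2 y, {in zs, forall z, pairing z y = 0} & pairing w y = 1.
Proof.
move=> wzs; apply: contrapT => nsep; apply: wzs.
have [|y ys|v vs wv] := @dual_span zs (pairing w); first exact: pairingDr.
  by case wy: (pairing w y) => //; case: nsep; exists y.
by rewrite (pairing_inj wv).
Qed.

(** An ultrafilter limit [h] of the finite solutions may lie outside G, but only countably many
    coordinates matter, and richness gives an [x] in G agreeing with [h] there. *)
Lemma pairing_saturated (u : nat -> G) (e : nat -> bool) :
    (forall N, exists y, forall n, (n < N)%N -> pairing (u n) y = e n) ->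
  exists y, forall n, pairing (u n) y = e n.
Proof.
move=> /choice[y yP]; have [U [UU Uoo]] := nat_ultrafilter.
have [h hP] := ultra_limit (fun n => y n : I -> bool) UU.
have [x xP] := rich_ext_seqs (fun n => row_supp (u n)) h.
exists x => n.
have Un : U [set m | {in row_supp (u n), forall i, y m i = h i}].
  apply: (@filter_in_seq _ U _ _ (fun i => [set m | y m i = h i])) => i _.
  exact: hP.
have [m [nm mh]] := filter_ex (filterI (Uoo n.+1) Un).
rewrite -(yP m n nm); apply: eq_big_seq => i si.
by rewrite (mh i si) (xP n i si).
Qed.

Definition prefix_seq (u : nat -> G) n := [seq u i | i <- iota 0 n].

Lemma independent_solve (u : nat -> G) (e : nat -> bool) :
    (forall n, ~ in_span (prefix_seq u n) (u n)) ->
  exists y, forall n, pairing (u n) y = e n.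
Proof.
move=> u_ind; apply: pairing_saturated; elim=> [|N [y yP]]; first by exists 0.
have [v vs uv] := separate_span (u_ind N).
have uv0 n : (n < N)%N -> pairing (u n) v = 0.
  by move=> nN; apply: vs; apply/mapP; exists n; rewrite // mem_iota.
(* [v] is orthogonal to the earlier terms and pairs to 1 with [u N], so adding it changes only the
   last equation. *)
exists (if pairing (u N) y == e N then y else y + v) => n.
rewrite ltnS leq_eqVlt => /predU1P[->|nN]; case: eqP => // uy.
- by rewrite pairingDr uv; case: (pairing _ _) uy; case: (e N).
- exact: yP.
- by rewrite pairingDr uv0 // addr0 yP.
Qed.

Lemma independent_no_accumulation (u : nat -> G) (x : G) :
    (forall n, ~ in_span (prefix_seq u n) (u n)) ->
  ~ accumulation_point u x.
Proof.
move=> u_ind ux.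
have [[N xN]|x_ind] := pselect (exists N, in_span (prefix_seq u N) x).
  (* [y] is orthogonal to the first N terms, hence to [x], and pairs to 1 with all later ones. *)
  have [y yP] := independent_solve (fun n => (N <= n)%N) u_ind.
  have xy : pairing x y = 0.
    rewrite pairingC.
    apply: (in_span_morph (c := pairing y)) xN; first exact: pairingDr.
    move=> _ /mapP[n + ->]; rewrite mem_iota add0n pairingC yP => /andP[_].
    by rewrite ltnNge => /negbTE.
  apply: (ux _ (nbhs_pairing x y)); apply: (sub_finite_set _ (finite_II N)).
  by move=> n /=; rewrite xy yP ltnNge => ->.
(* With [x] put in front, saturation gives [y] pairing to 1 with [x] and to 0 with every term. *)
pose u' n := if n is m.+1 then u m else x.
pose e n := n == 0%N.
have [N|y yP] := @pairing_saturated u' e.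
  have [v vs xv] : exists2 v, {in prefix_seq u N, forall z, pairing z v = 0} &
      pairing x v = 1.
    by apply: separate_span => xN; apply: x_ind; exists N.
  exists v => -[_|n nN]; [exact: xv|apply: vs]; apply/mapP; exists n => //.
  by rewrite mem_iota; exact: ltnW nN.
apply: (ux _ (nbhs_pairing x y)).
rewrite (_ : [set n | _] = set0); first exact: finite_set0.
apply/seteqP; split=> n //=.
by have /= -> := yP n.+1; have /= -> := yP 0%N.
Qed.

End rich.

Lemma row_space_hausdorff (I : choiceType) (b : I -> I -> bool) :
  hausdorff_space (row_space b).
Proof.
move=> x y xy; apply: row_ext => i.
have [z [zx zy]] := xy _ _ (nbhs_row x [:: i]) (nbhs_row y [:: i]).
by rewrite -(zx i) -?(zy i) ?mem_head.
Qed.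

(** * The elements 1 and -1 of the circle *)

Section circle_sign.
Variable R : realType.

Fact circle_minus_one_subproof : (-1 : complex_plane R) \in @unit_circle R.
Proof. by apply/mem_set; rewrite /unit_circle /= normrN1. Qed.

Definition circle_sign (c : bool) : circle R :=
  if c then (SigSub circle_minus_one_subproof : circle R) else 0.

Lemma circle_signD : {morph circle_sign : c d / c + d}.
Proof.
by case=> -[]; apply/val_inj; rewrite val_circleD /= ?mulr1 ?mul1r ?mulrNN ?mulr1.
Qed.

Lemma circle_sign_dist c d :
  `|val (circle_sign c) - val (circle_sign d)| < 1 -> c = d.
Proof.
have two : (`|1 + 1 : complex_plane R| < 1) = false.
  by rewrite -mulr2n normr_nat (ltrn1 _ 2).
case: c; case: d => //=; first by rewrite -opprD normrN two.
by rewrite opprK two.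
Qed.

Lemma circle_sign_inj : injective circle_sign.
Proof. by move=> c d cd; apply: circle_sign_dist; rewrite cd subrr normr0. Qed.

Lemma circle_signP (z : circle R) : z + z = 0 -> exists c, z = circle_sign c.
Proof.
move=> /(congr1 val); rewrite val_circleD -expr2 val_circle0 => /eqP.
rewrite sqrf_eq1 => /orP[|] /eqP z1; [exists false|exists true];
  exact/val_inj.
Qed.

Lemma circle_sign_locally_constant (X : topologicalType) (g : X -> circle R)
    (c : X -> bool) (x : X) :
    continuous g -> (forall y, g y = circle_sign (c y)) ->
  nbhs x [set y | c y = c x].
Proof.
move=> g_cont gc.
have vg : continuous (fun y => val (g y) : complex_plane R).
  move=> y; apply: (@continuous_comp _ _ _ g); first exact: g_cont.
  exact: continuous_circle_val.
have := @cvgr_dist_lt _ _ _ _ (nbhs_filter x) _ _ (vg x) 1 ltr01.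
by apply: filterS => y; rewrite !gc => /circle_sign_dist.
Qed.

End circle_sign.

(** * Maps into and out of the dual *)

Section dual_topology.
Variables (R : realType) (G : topologicalZmodType).

Lemma continuous_to_dual (X : topologicalType) (f : X -> dual R G) :
  continuous (fun x => val (f x) : {compact-open, G -> circle R}) ->
  continuous f.
Proof.
move=> /continuousP cf; apply/continuousP => _ [V oV <-].
exact: (cf V oV).
Qed.

Lemma continuous_dual_val :
  continuous (fun f : dual R G => val f : {compact-open, G -> circle R}).
Proof. exact: (@initial_continuous (dual R G) _ set_val). Qed.

Lemma dual_eval_continuous (x : G) : continuous (fun f : dual R G => f x).
Proof.
move=> f A; rewrite nbhsE => -[W [oW Wfx] WA].
have : nbhs (val f : {compact-open, G -> circle R})
    [set g | g @` [set x] `<=` W].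
  apply: open_nbhs_nbhs; split; last by move=> _ [_ -> <-].
  by apply: compact_open_open => //; exact: compact_set1.
move=> /(@continuous_dual_val f _) fW.
suff: nbhs f [set g : dual R G | A (g x)] by [].
have fF : Filter (nbhs (f : dual R G)) by exact: nbhs_filter.
apply: (@filterS _ _ fF _ _ _ fW) => g /= gW.
by apply: WA; apply: gW; exists x.
Qed.

End dual_topology.

(** * Pseudocompactness and compact subsets *)

Section rich_topology.
Variables (I : choiceType) (b : I -> I -> bool).
Hypothesis b_rich : rich_matrix b.
Local Notation G := (row_space b).

(** If |f (g n)| > n, this persists on the points agreeing with [g n] on a finite [s n]. Some [x] in
    G agrees with an ultrafilter limit of [g] on every [s n], and for some large m a point [y] is
    close to both [x] and [g m]. *)
Lemma rich_pseudocompact (R : realType) : pseudocompact R G.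
Proof.
move=> f f_cont; apply: contrapT => /forallNP unb.
have /choice[g gP] : forall n : nat, exists x : G, n%:R < `|f x|.
  by move=> n; have /existsNP[x /negP] := unb n%:R; rewrite -ltNge; exists x.
have /choice[s sP] : forall n, exists s : seq I,
    forall y : G, {in s, y =1 g n} -> n%:R < `|f y|.
  move=> n; have := f_cont (g n) [set r | n%:R < `|r|].
  apply; apply: open_nbhs_nbhs; split; last exact: gP.
  apply: (@open_comp R R Num.norm [set r | n%:R < r]); last exact: open_gt.
  by move=> r _; exact: norm_continuous.
have [U [UU Uoo]] := nat_ultrafilter.
have [h hP] := ultra_limit (fun n => g n : I -> bool) UU.
have [x xh] := rich_ext_seqs b_rich s h.
have [t tP] : nbhs x [set y | `|f y| < `|f x| + 1].
  have := f_cont x [set r | `|r| < `|f x| + 1]; apply.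
  apply: open_nbhs_nbhs; split; last by rewrite /= ltrDl.
  apply: (@open_comp R R Num.norm [set r | r < `|f x| + 1]).
    by move=> r _; exact: norm_continuous.
  exact: open_lt.
have [N Nx] : exists N : nat, `|f x| + 1 < N%:R.
  by exists (Num.truncn (`|f x| + 1)).+1; exact: truncnS_gt.
have Ut : U [set m | {in t, forall i, g m i = h i}].
  apply: (@filter_in_seq _ U _ _ (fun i => [set m | g m i = h i])) => i _.
  exact: hP.
have [m [Nm mh]] := filter_ex (filterI (Uoo N) Ut).
(* x is a limit of the [g n] on the union of the supports [s n], so the
   prescriptions of [g m] on [s m] and of [x] on [t] are compatible. *)
have [y yP] := rich_ext_seq b_rich (s m ++ t)
  (fun i => if i \in s m then g m i else x i).
have /sP : {in s m, y =1 g m}.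
  by move=> i si; rewrite yP ?si // mem_cat si.
have /tP /= : {in t, y =1 x}.
  move=> i ti; rewrite yP ?mem_cat ?ti ?orbT //; case: ifPn => // si.
  by rewrite (mh i ti) (xh m i si).
move=> /lt_trans/(_ Nx) yN my; have := lt_trans my yN; rewrite ltr_nat ltnNge.
by move: Nm => /= ->.
Qed.

(** Finite lists have finite spans, so an infinite [K] would contain an independent sequence. *)
Lemma rich_compact_finite (K : set G) : compact K -> finite_set K.
Proof.
move=> Kc; apply: contrapT => Koo.
have /choice[v vP] : forall s : seq G, exists x, K x /\ ~ in_span s x.
  move=> s; apply: contrapT => /forallNP Ks; apply: Koo.
  have [t st] := finite_in_span (@row_boolean _ b) s.
  apply: (sub_finite_set _ (finite_seq t)) => x Kx; apply: st.
  by apply: contrapT => sx; apply: (Ks x).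
pose fix pre n := if n is m.+1 then rcons (pre m) (v (pre m)) else [::].
pose u n := v (pre n).
have preE n : prefix_seq u n = pre n.
  elim: n => // n IH.
  by rewrite /prefix_seq -addn1 iotaD map_cat -/(prefix_seq u n) IH cats1 addn1.
have u_ind n : ~ in_span (prefix_seq u n) (u n) by rewrite preE; exact: (vP _).2.
have [|x [Kx xu]] := Kc (u @ \oo) _.
  by exists 0%N => // n _; exact: (vP _).1.
apply: (independent_no_accumulation b_rich u_ind (x := x)) => V xV.
move=> /finite_seqP[s sV].
(* All indices past the maximum of [s] lie outside [s], so the cluster point forces a visit to [V]
   at an index not in [s]. *)
have [|_ [[n /= ns <-] Vn]] := xu [set u n | n in [set n | n \notin s]] V _ xV.
  exists (\max_(i <- s) i).+1 => // n /= sn; exists n => //=.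
  apply/negP => ns; move: sn; rewrite ltnNge => /negP; apply.
  exact: leq_bigmax_seq.
have : [set n | V (u n)] n by [].
by rewrite sV => /= ns'; rewrite ns' in ns.
Qed.

(** * Failure of selective pseudocompactness *)

(** Triangular elimination: at [i m] the later terms vanish and [u m] is 1, so a zero of [w] there
    excludes [u m] from the combination. *)
Lemma in_span_vanish (i : nat -> I) (u : nat -> G) m n (w : G) :
    (forall k, u k (i k) = 1) ->
    (forall k l, (l < k)%N -> u k (i l) = 0) ->
    (forall k, (m <= k < m + n)%N -> w (i k) = 0) ->
  in_span [seq u k | k <- iota m n] w -> w = 0.
Proof.
move=> u1 u0; elim: n m w => [//|n IH] m w w0 /= [wu|wu].
  by apply: IH wu => k /andP[mk kn]; apply: w0; rewrite ltnW // addnS -addSn.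
have : (w + u m : G) (i m) = 0.
  apply: (in_span_morph (c := fun x : G => x (i m))) wu.
    by move=> x y; exact: rowDE.
  move=> _ /mapP[k + ->]; rewrite mem_iota => /andP[mk _]; exact: u0.
by rewrite rowDE u1 w0 // leqnn /= -[X in (X < _)%N]addn0 ltn_add2l.
Qed.

Lemma rich_not_selectively_pseudocompact (i : nat -> I) :
  injective i -> ~ selectively_pseudocompact G.
Proof.
move=> i_inj /(_ (fun n => [set x : G |
  (forall k, (k < n)%N -> x (i k) = 0) /\ x (i n) = 1])) [n|u [uU [x]]].
  split.
    rewrite openE => x [x0 x1]; exists [seq i k | k <- iota 0 n.+1] => y yx.
    have {}yx k : (k <= n)%N -> y (i k) = (x : G) (i k).
      by move=> kn; apply: yx; apply/map_f; rewrite mem_iota.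
    by split=> [k kn|]; rewrite yx ?leqnn ?(ltnW kn) //; exact: x0.
  have [x xP] := rich_ext b_rich i (fun j => j == i n).
  exists x; split=> [k kn|]; rewrite xP ?eqxx //.
  by apply/negbTE/eqP => /i_inj kn'; rewrite kn' ltnn in kn.
apply: independent_no_accumulation => // n un.
(* [u n] vanishes at [i k] for k < n, so a dependence on the earlier terms would make it zero,
   against its value 1 at [i n]. *)
have := (uU n).2; suff -> : u n = 0 by rewrite row0E.
apply: (in_span_vanish (i := i)) un => [k|k l lk|k /andP[_ kn]].
- exact: (uU k).2.
- exact: (uU k).1.
- exact: (uU n).1.
Qed.


(** * Strong self-duality *)

Variable R : realType.

Fact pairing_character_subproof (x : G) :
  ((fun y => circle_sign R (pairing x y)) : {compact-open, G -> circle R})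
    \in @is_character R G.
Proof.
apply/mem_set; split=> [y A Ay|y z]; last by rewrite pairingDr circle_signD.
apply: filterS (nbhs_pairing b_rich y x) => z /= zy.
by rewrite (pairingC b_rich) zy (pairingC b_rich); exact: (nbhs_singleton Ay).
Qed.

Definition pairing_character (x : G) : dual R G :=
  SigSub (pairing_character_subproof x).

Lemma pairing_characterE (x y : G) :
  pairing_character x y = circle_sign R (pairing x y).
Proof. by []. Qed.

Lemma pairing_character_continuous : continuous pairing_character.
Proof.
apply: continuous_to_dual => x.
apply/(compact_open_cvgP _ (fmap_filter _ (nbhs_filter x))) => K O Kc _ KO.
have /finite_seqP[s Ks] := rich_compact_finite Kc.
have : nbhs x [set z : G | {in s, forall y, pairing z y = pairing x y}].
  apply: (@filter_in_seq _ _ _ _ (fun y : G => [set z : G | pairing z y = pairing x y])).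
  by move=> y _; exact: nbhs_pairing.
apply: filterS => z zx _ [y Ky <-]; apply: KO; exists y => //=.
by rewrite zx //; rewrite Ks in Ky.
Qed.

Lemma dual_sign (f : dual R G) x : exists c, f x = circle_sign R c.
Proof.
apply: circle_signP; rewrite -dualD row_boolean.
by apply: (@addrI _ (f 0)); rewrite -dualD !addr0.
Qed.

(** The sign [c] of [f] is locally constant, hence 0 wherever finitely many coordinates vanish; so
    it is a combination of pairings with the corresponding rows. *)
Lemma pairing_character_surj (f : dual R G) :
  exists x, f = pairing_character x.
Proof.
have /choice[c fc] := dual_sign f.
have cD : {morph c : x y / x + y}.
  move=> x y; apply: (@circle_sign_inj R).
  by rewrite circle_signD -!fc dualD.
have c0 : c 0 = 0 by have := cD 0 0; rewrite addr0; case: (c 0).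
have [s sP] : nbhs (0 : G) [set y : G | c y = 0].
  rewrite -c0; apply: (@circle_sign_locally_constant R G f c 0 _ fc).
  exact: dual_continuous.
have [|w _ wc] := dual_span b_rich (zs := [seq row_vec b [:: i] | i <- s]) cD.
  move=> y ys; apply: sP => i si; rewrite row0E -(pairing_row b_rich).
  by rewrite (pairingC b_rich) ys //; apply/mapP; exists i.
by exists w; apply: dual_ext => y; rewrite fc wc.
Qed.

Lemma rich_strongly_self_dual : strongly_self_dual R G.
Proof.
exists pairing_character; split; last first.
  by move=> x y; rewrite !pairing_characterE (pairingC b_rich).
have /choice[psi psiK] := pairing_character_surj.
split=> [x y|].
  by apply: dual_ext => z; rewrite pairing_characterE (pairingDl b_rich) circle_signD.
exists psi; split.
- move=> x; apply: (pairing_inj b_rich) => y; apply: (@circle_sign_inj R).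
  by rewrite -!pairing_characterE -psiK.
- by move=> f; rewrite -psiK.
- exact: pairing_character_continuous.
(* Coordinate [i] of [psi g] is the sign of [g] at the row of [i], and evaluation is continuous. *)
move=> f A [s sA].
have : nbhs f [set g : dual R G | {in s, forall i, psi g i = psi f i}].
  apply: (@filter_in_seq _ _ _ _
    (fun i => [set g : dual R G | psi g i = psi f i])) => i _.
  apply: (@circle_sign_locally_constant R _
    (fun g : dual R G => g (row_vec b [:: i])) (fun g => psi g i)).
    exact: dual_eval_continuous.
  by move=> g; rewrite [in LHS](psiK g) pairing_characterE (pairing_row b_rich).
by apply: filterS => g gs; apply: sA => i si; exact: gs.
Qed.

End rich_topology.

(** * Marked trees, their adjacency matrix and their coding in K *)

Inductive marked_tree (K : Type) : Type :=
| marked_leaf of K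
| marked_node of (nat -> marked_tree K) & (nat -> bool).

HB.instance Definition _ (K : Type) := gen_eqMixin (marked_tree K).
HB.instance Definition _ (K : Type) := gen_choiceMixin (marked_tree K).

Section marked_tree.
Variable K : Type.
Implicit Types t i j : marked_tree K.

Definition subtree t i : Prop :=
  if t is marked_node f _ then exists n, f n = i else False.

Definition marked_subtree t i : Prop :=
  if t is marked_node f h then exists2 n, f n = i & h n else False.

Definition tree_matrix i j : bool :=
  `[< marked_subtree i j \/ marked_subtree j i >].

Lemma marked_subtreeW t i : marked_subtree t i -> subtree t i.
Proof. by case: t => //= f h [n fn _]; exists n. Qed.

Lemma subtree_asym t i : subtree t i -> ~ subtree i t.
Proof.
elim: t i => [//|f IH h] _ [n <-] fnt; apply: (IH n _ fnt).
by exists n.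
Qed.

Lemma tree_matrix_rich : rich_matrix tree_matrix.
Proof.
split=> [i j|j A]; first by apply: asbool_equiv_eq; rewrite orC.
(* The bits [A \o j] agree on repeated subtrees, so any position [m] with j m = j n decides the same
   bit. *)
exists (marked_node j (A \o j)) => n; apply/asboolP/idP.
  case=> [[m <-]//|/marked_subtreeW/subtree_asym[]].
  by exists n.
by move=> An; left; exists n.
Qed.

Variables (num : nat -> K) (code : (nat -> K) -> K).
Hypotheses (num_inj : injective num) (code_inj : injective code).

(** The length is stored first, so the padding by [num 0] causes no ambiguity. *)
Definition code_seq (s : seq K) : K :=
  code (fun n => if n is m.+1 then nth (num 0) s m else num (size s)).

Lemma code_seq_inj : injective code_seq.
Proof.
move=> s t /code_inj st.
have /num_inj sz : num (size s) = num (size t).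
  exact: (congr1 (fun a : nat -> K => a 0%N) st).
apply: (@eq_from_nth _ (num 0)) => // n _.
exact: (congr1 (fun a : nat -> K => a n.+1) st).
Qed.

(** Leaves and nodes are told apart by the lengths 1 and 2 of the coded lists. *)
Fixpoint code_tree t : K :=
  match t with
  | marked_leaf k => code_seq [:: k]
  | marked_node f h => code_seq
      [:: code (fun n => code_tree (f n)); code (fun n => num (h n))]
  end.

Lemma code_tree_inj : injective code_tree.
Proof.
elim=> [k|f IH h] [l|g e] /= /code_seq_inj //; first by case=> ->.
case=> /code_inj fg /code_inj he; congr marked_node; apply/funext => n.
  by apply: IH; exact: (congr1 (fun a : nat -> K => a n) fg).
have /num_inj := congr1 (fun a : nat -> K => a n) he.
by case: (h n) (e n) => -[].
Qed.

End marked_tree.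

(** * Cardinal comparisons *)

Lemma injective_card_le (T U : Type) (A : set U) (f : T -> U) :
  injective f -> (forall x, A (f x)) -> [set: T] #<= A.
Proof.
move=> f_inj fA; have [g] : $|{injfun [set: T] >-> A}|.
  by apply/injfunPex; exists f => [x _|x y _ _ /f_inj]; first exact: fA.
exact: inj_card_le g.
Qed.

Lemma card_le_injective (T U : Type) :
  [set: T] #<= [set: U] -> exists f : T -> U, injective f.
Proof.
move=> /card_leP[f].
exists (fun x => val (f (SigSub (mem_set (I : [set: T] x))))) => x y.
move=> /val_inj /(@inj _ _ _ f); rewrite !inE => /(_ I I).
by move=> /(congr1 val).
Qed.

(* Diagonalising over the fibres of [r] as in Koenig's theorem: if no fibre
   projected onto K, a sequence avoiding the n-th projection of the n-th fibre
   for every n would have no code. *)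
Lemma countable_to_one_injective (K T : Type) (code : (nat -> K) -> K)
    (f : K -> T) (r : K -> nat) :
    injective code ->
    (forall x y, f x = f y -> r x = r y -> x = y) ->
  exists a : K -> K, injective (f \o a).
Proof.
move=> code_inj fr.
have [n /choice[a aP]] : exists n, forall k, exists a,
    a n = k /\ r (code a) = n.
  apply: contrapT => /forallNP N; have /choice[k kP] : forall n, exists k,
      ~ exists a, a n = k /\ r (code a) = n.
    by move=> n; apply/existsNP; exact: N.
  by case: (kP (r (code k))); exists k.
exists (code \o a) => k l /fr.
rewrite (aP k).2 (aP l).2 => /(_ erefl)/code_inj kl.
by rewrite -(aP k).1 -(aP l).1 kl.
Qed.

(** * Bases of the row space *)

Section weight.
Variables (I : choiceType) (b : I -> I -> bool).
Hypothesis b_rich : rich_matrix b.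
Local Notation G := (row_space b).

Lemma row_vec1_inj : injective (fun i => row_vec b [:: i]).
Proof.
move=> i j ij; have [x xP] := rich_ext_seq b_rich [:: i; j] (pred1 i).
have : x i = x j by rewrite -!(pairing_row b_rich) ij.
by rewrite !xP ?inE ?eqxx ?orbT // => /esym/eqP.
Qed.

Definition cylinder (p : seq (I * bool)) : set G :=
  [set x : G | {in p, forall q, x q.1 = q.2}].

Lemma cylinder_basis : basis (range cylinder).
Proof.
split=> [_ [p _ <-]|x A [s sA]].
  rewrite openE => x xp; exists (map fst p) => y yx q qp.
  by rewrite (yx q.1) ?xp //; exact: map_f.
pose p := [seq (i, (x : G) i) | i <- s].
exists (cylinder p); first by split; [exists p|move=> _ /mapP[i _ ->]].
by move=> y yP; apply: sA => i si; apply: (yP (i, (x : G) i)); exact: map_f.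
Qed.

(** [f y] is a basic neighbourhood of 0 inside the kernel of [y]. A given U contains the common
    kernel of finitely many rows, so every [y] with f y = U lies in their finite span; [r] is its
    position in a list of that span. *)
Lemma basis_fibre (B : set (set G)) : basis B ->
  exists (f : G -> set G) (r : G -> nat), (forall y, B (f y)) /\
    forall x y, f x = f y -> r x = r y -> x = y.
Proof.
move=> [Bo Bb].
have /choice[f fP] : forall y : G, exists U : set G,
    [/\ B U, U 0 & U `<=` [set z | pairing z y = 0]].
  move=> y; have := Bb 0 [set z | pairing z y = 0].
  have -> : [set z | pairing z y = 0] = [set z | pairing z y = pairing 0 y].
    by rewrite (pairingC b_rich 0) pairing0r.
  by move=> /(_ (nbhs_pairing b_rich 0 y))[U [BU U0] Uy]; exists U.
have /choice[s sP] : forall U : set G, exists s : seq G, forall y,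
    f y = U -> y \in s.
  move=> U; have [[y0 fy0]|nU] := pselect (exists y, f y = U); last first.
    by exists [::] => y fy; case: nU; exists y.
  have [BU U0 _] := fP y0; rewrite fy0 in BU U0.
  have [t tU] : nbhs (0 : G) U by apply: open_nbhs_nbhs; split=> //; exact: Bo.
  have [s ts] := finite_in_span (@row_boolean _ b) [seq row_vec b [:: i] | i <- t].
  exists s => y fy; apply: ts.
  have [||w wt wy] := @dual_span _ _ b_rich [seq row_vec b [:: i] | i <- t]
    (pairing y).
  - exact: pairingDr.
  - move=> z zt; rewrite (pairingC b_rich).
    have [_ _] := fP y; rewrite fy; apply; apply: tU => i ti.
    rewrite row0E -(pairing_row b_rich) (pairingC b_rich) zt //.
    by apply/mapP; exists i.
  by rewrite (pairing_inj b_rich wy).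
exists f, (fun y => index y (s (f y))); split=> [y|x y fxy].
  by have [] := fP y.
rewrite fxy => xy.
by rewrite -(nth_index 0 (sP _ x fxy)) xy nth_index // sP.
Qed.

End weight.

(* The cardinal kappa is represented by a type K. *)
Theorem corollary5p7 (R : realType) (K : Type)
    (K_infinite : infinite_set [set: K])
    (K_omega : [set: nat -> K] #= [set: K]) :
  exists G : topologicalZmodType,
    [/\ hausdorff_space G, boolean_group G, pseudocompact R G
      & strongly_self_dual R G] /\
    [/\ ~ selectively_pseudocompact G, [set: G] #= [set: K] & weight_eq G K].
Proof.
have [num num_inj] : exists f : nat -> K, injective f.
  by apply: card_le_injective; exact/infiniteP.
have [code code_inj] : exists f : (nat -> K) -> K, injective f.
  by apply: card_le_injective; move: K_omega; rewrite card_eq_le => /andP[].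
pose b := @tree_matrix K; have b_rich : rich_matrix b := tree_matrix_rich K.
have leaf_inj : injective (@marked_leaf K) by move=> k l [].
have tree_inj := code_tree_inj num_inj code_inj.
pose row k := row_vec b [:: marked_leaf k].
have row_inj : injective row by move=> k l /(row_vec1_inj b_rich)/leaf_inj.
exists (row_space b); split; split.
- exact: row_space_hausdorff.
- exact: row_boolean.
- exact: rich_pseudocompact.
- exact: rich_strongly_self_dual.
- apply: (rich_not_selectively_pseudocompact b_rich
    (i := fun n => marked_leaf (num n))).
  by move=> m n /leaf_inj/num_inj.
- rewrite card_eq_le; apply/andP; split; last exact: (injective_card_le row_inj).
  apply: (@injective_card_le _ _ _
    (fun x => code_seq num code (map (code_tree num code) (row_supp x)))) => //.
  move=> x y /(code_seq_inj num_inj code_inj)/(inj_map tree_inj).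
  exact: (can_inj (@row_suppK _ b)).
(* K embeds in G by the rows of leaves, and the fibres of [f] are separated by [r]; the coding of
   sequences turns this into an injection of K into [B]. *)
have lower (B : set (set (row_space b))) : basis B -> [set: K] #<= B.
  move=> /(basis_fibre b_rich)[f [r [fB fr]]].
  have [|a a_inj] := countable_to_one_injective (f := f \o row) (r := r \o row)
    code_inj.
    by move=> k l /= fkl rkl; apply: row_inj; exact: fr.
  by apply: (injective_card_le a_inj) => k; exact: fB.
split=> //; exists (range (@cylinder _ b)); first exact: cylinder_basis.
rewrite card_eq_le lower ?andbT; last exact: cylinder_basis.
suff seqK : [set: seq (marked_tree K * bool)] #<= [set: K].
  exact: card_le_trans (card_image_le _ _) seqK.
apply: (@injective_card_le _ _ _ (fun p : seq (marked_tree K * bool) =>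
  code_seq num code [seq code_seq num code
    [:: code_tree num code q.1; num q.2] | q : marked_tree K * bool <- p])) => //.
move=> p q /(code_seq_inj num_inj code_inj)/inj_map; apply.
move=> [i d] [j e] /(code_seq_inj num_inj code_inj)[/tree_inj -> /num_inj].
by case: d e => -[].
Qed.
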